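(* Let $g:\mathbb{R}^m\to\bar{\mathbb{R}}$ be a proper convex function and $A\in\mathbb{R}^{m\times n}$ a matrix (identified with the linear map $\mathbb{R}^n\to\mathbb{R}^m$; no invertibility is assumed). Let $T:=T(\operatorname{dom}(g),\operatorname{range}(A))$ be the joint supporting subspace. Then for every $x\in\mathbb{R}^n$, $$\partial(g\circ A)(x)=A^T\,\partial(g+\iota_T)(Ax),$$ where $A^T S=\{A^T s\mid s\in S\}$.
   Context: $\bar{\mathbb{R}}=\mathbb{R}\cup\{-\infty,\infty\}$. For convex $f$, $\operatorname{dom}(f)=\{x: f(x)\neq\infty\}$; $f$ is proper if it is nowhere $-\infty$ and $\operatorname{dom}(f)\ne\emptyset$. The subdifferential is $\partial f(x)=\{v \mid \forall y,\ f(x)+\langle v,y-x\rangle\le f(y)\}$ for $x\in\operatorname{dom}(f)$, and $\partial f(x)=\emptyset$ when $x\notin\operatorname{dom}(f)$. For a set $S$, $\iota_S$ is the indicator function, $0$ on $S$ and $\infty$ off $S$. $C-D=\{c-d\mid c\in C,d\in D\}$. Faces: for $C\subseteq\mathbb{R}^m$ convex, a subset $F\subseteq C$ is a face of $C$ if for all $y,z\in C$, whenever the open segment $]y,z[ = [y,z]\setminus\{y,z\}$ meets $F$, both $y,z\in F$. For $S\subseteq C$, $F_C(S)$ denotes the smallest face of $C$ containing $S$; $F_C(x)=F_C(\{x\})$. Joint supporting subspace: for convex $C,D\subseteq\mathbb{R}^m$ with $C\cap D\neq\emptyset$, $T(C,D):=\operatorname{Span} F_{C-D}(0)$ (linear span).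 If $C\cap D=\emptyset$ (so $0\notin C-D$), read $F_{C-D}(0)$ as $\emptyset$, so that $T(C,D)=\{0\}$. *)

(* Defs.v *)
From mathcomp Require Import all_boot all_order all_algebra.
From mathcomp Require Import boolp classical_sets set_interval.
From mathcomp Require Import reals ereal convex.

Set Implicit Arguments.
Unset Strict Implicit.
Unset Printing Implicit Defensive.

Import Order.TTheory GRing.Theory Num.Theory.

Local Open Scope classical_set_scope.
Local Open Scope ring_scope.
Local Open Scope ereal_scope.

Section Sets.
Context {R : realType} {m : nat}.
Implicit Types (x y z : 'cV[R]_m) (C D F S : set 'cV[R]_m).

Definition dotv x y : R := ((x^T *m y) 0 0)%R.

Definition closed_segment y z : set 'cV[R]_m :=
  [set ((1 - t) *: y + t *: z)%R | t in `[0%R, 1%R]%classic].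

(* With this convention ]y, y[ is empty. *)
Definition open_segment y z : set 'cV[R]_m :=
  closed_segment y z `\` [set y; z].

Definition face C F : Prop :=
  F `<=` C /\
  forall y z, C y -> C z -> open_segment y z `&` F !=set0 -> F y /\ F z.

(* [smallest] intersects all faces of C containing S, and C is one of them when
   S `<=` C.  When S is not included in C there is no such face, and the result
   is the empty set (the bare [smallest] would be the whole space). *)
Definition face_hull C S : set 'cV[R]_m :=
  [set x | S `<=` C /\ smallest (face C) S x].

Definition linear_span S : set 'cV[R]_m :=
  smallest [set V : set 'cV[R]_m | GRing.submod_closed (mem V)] S.

Definition set_diff C D : set 'cV[R]_m :=
  [set (c - d)%R | c in C & d in D].

Definition joint_support C D : set 'cV[R]_m :=
  linear_span (face_hull (set_diff C D) [set 0%R]).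

End Sets.

Section Functions.
Context {R : realType} {m : nat}.
Implicit Types (f : 'cV[R]_m -> \bar R) (S : set 'cV[R]_m).

Definition edom f : set 'cV[R]_m := [set x | f x <> +oo].

Definition epigraph f : set ('cV[R]_m * R^o) := [set p | f p.1 <= (p.2 : R)%:E].

(* For functions with values in \bar R, possibly taking both infinite values,
   convexity means convexity of the epigraph. *)
Definition convex_efun f : Prop := convex_set (epigraph f).

Definition proper_efun f : Prop :=
  (forall x, f x <> -oo) /\ edom f !=set0.

Definition eindic S : 'cV[R]_m -> \bar R :=
  fun x => if x \in S then 0 else +oo.

Definition subdifferential f (x : 'cV[R]_m) : set 'cV[R]_m :=
  [set v | edom f x /\ forall y, f x + (dotv v (y - x)%R)%:E <= f y].

End Functions.

(* Main.v *)
Require Import Defs.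
From mathcomp Require Import all_boot all_order all_algebra.
From mathcomp Require Import boolp classical_sets set_interval.
From mathcomp Require Import reals ereal convex.
From mathcomp Require Import interval_inference lra.

Set Implicit Arguments.
Unset Strict Implicit.
Unset Printing Implicit Defensive.

Import Order.TTheory GRing.Theory Num.Theory.

Local Open Scope classical_set_scope.
Local Open Scope ring_scope.

(** Write C := dom g - range A and let T be the span of the smallest face of C
    containing 0.  When A x is outside dom g both sides are empty; otherwise 0
    belongs to C.

    The inclusion from right to left follows from the containment of range A in
    T, by testing the subgradient inequality of g + iota_T at A x on range A.
    The containment holds because C, which is stable under translations by
    range A, contains the line through 0 and any A y, and a face through 0
    contains every such line ([span_face_hullN]).

    The other inclusion is a Hahn-Banach extension in finite dimension.  If w
    is a subgradient of g o A at x, then w vanishes on ker A, so that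
    w = A^T v0 for some v0 ([trmx_image]), and v0 satisfies the subgradient
    inequality of g at A x in the directions of range A.  One has to change v0
    so that the inequality holds in all directions of T, without changing its
    values on range A.  This is possible without any closedness or interior
    assumption on dom g because every u in T has a positive multiple in C, that
    is, a positive multiple that a translation by an element of range A brings
    into dom g ([span_face_hull_sub_conic]).  Indeed 0 is in the relative
    interior of its own face; in algebraic terms, that face lies in the largest
    linear subspace of the cone generated by C.

    The extension ([dotv_extension]) starts from linear equations for range A
    and drops them one at a time.  Dropping the equation q costs one choice: a
    number c such that v0 + c q satisfies the inequality on the larger
    subspace.  That c is the slope of a line through the origin that supports
    a convex subset of the plane from below ([supporting_slope]). *)

(** * Convex sets in terms of real weights *)

Lemma convex_setP (R : realType) (M : lmodType R) (S : set M) :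
  convex_set S <-> forall x y (a b : R), 0 < a -> 0 < b -> a + b = 1 ->
    S x -> S y -> S (a *: x + b *: y).
Proof.
split=> [Sc x y a b a0 b0 ab Sx Sy|Sc].
- have a1 : a <= 1 by lra.
  have -> : b = 1 - a by lra.
  exact: set_mem (Sc x y (Itv01 (ltW a0) a1) (mem_set Sx) (mem_set Sy)).
apply/convex_setW => x y /set_mem Sx /set_mem Sy k k0 k1; apply/mem_set.
by apply: (Sc x y k%:num (1 - k%:num)) => //; lra.
Qed.

(** * Extension of subgradients *)

(** A planar convex set that meets the vertical axis only at nonnegative
    heights, and has points on both sides of the axis, lies above a line through
    the origin.  The slopes y.2 / y.1 of the points on the left are at most the
    slopes of the points on the right, since the segment between two such points
    crosses the axis; any number in between will do.  Points on both sides are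
    required for this gap to be bounded. *)
Lemma supporting_slope (R : realType) (Q : set (R^o * R^o)) :
  convex_set Q ->
  (forall h, Q (0, h) -> 0 <= h) ->
  (exists2 x, Q x & 0 < x.1) -> (exists2 y, Q y & y.1 < 0) ->
  exists c, forall x, Q x -> c * x.1 <= x.2.
Proof.
move=> /convex_setP Qc Q0 [x0 Qx0 x0_gt0] [y0 Qy0 y0_lt0].
have Qconv x y (a b : R) : 0 < a -> 0 < b -> a + b = 1 -> Q x -> Q y ->
  Q (a * x.1 + b * y.1, a * x.2 + b * y.2) by exact: Qc.
have cross x y : Q x -> Q y -> 0 < x.1 -> y.1 < 0 -> y.2 / y.1 <= x.2 / x.1.
  move=> Qx Qy x1 y1; have d : 0 < x.1 - y.1 by lra.
  (* These weights put the convex combination on the vertical axis. *)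
  have := Qconv x y (- y.1 / (x.1 - y.1)) (x.1 / (x.1 - y.1)).
  rewrite !divr_gt0 ?oppr_gt0// -mulrDl addrC divff ?gt_eqF//.
  move=> /(_ isT isT erefl Qx Qy).
  have -> : - y.1 / (x.1 - y.1) * x.1 + x.1 / (x.1 - y.1) * y.1 = 0.
    by rewrite mulrAC mulNr (mulrAC x.1) (mulrC y.1) mulNr addNr.
  move=> /Q0; rewrite mulrAC (mulrAC x.1) -mulrDl pmulr_lge0 ?invr_gt0// => h.
  rewrite ler_pdivlMr// mulrAC ler_ndivrMr//; lra.
pose S := [set y.2 / y.1 | y in [set y | Q y /\ y.1 < 0]].
have S_ub x : Q x -> 0 < x.1 -> ubound S (x.2 / x.1).
  by move=> Qx x1 _ [y [Qy y1] <-]; exact: cross.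
exists (sup S) => x Qx; have [x1|x1|x1] := ltgtP x.1 0.
- rewrite -ler_ndivrMr//; apply: ub_le_sup; last by exists x.
  by exists (x0.2 / x0.1); exact: S_ub.
- rewrite -ler_pdivlMr//; apply: ge_sup; last exact: S_ub.
  by exists (y0.2 / y0.1), y0.
- by rewrite x1 mulr0; apply: Q0; rewrite -x1 -surjective_pairing.
Qed.

Section Dot.
Variables (R : realType) (m : nat).
Implicit Types (u v q z : 'cV[R]_m).

Lemma dotvDr v z u : dotv v (z + u) = dotv v z + dotv v u.
Proof. by rewrite /dotv mulmxDr mxE. Qed.

Lemma dotvZr v (a : R) z : dotv v (a *: z) = a * dotv v z.
Proof. by rewrite /dotv -scalemxAr mxE. Qed.

Lemma dotvC u v : dotv u v = dotv v u.
Proof. by rewrite /dotv -[in RHS](trmxK u) -trmx_mul [RHS]mxE. Qed.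

Lemma dotvDl u v z : dotv (u + v) z = dotv u z + dotv v z.
Proof. by rewrite dotvC dotvDr !(dotvC z). Qed.

Lemma dotvZl (a : R) v z : dotv (a *: v) z = a * dotv v z.
Proof. by rewrite dotvC dotvZr dotvC. Qed.

(** Hahn-Banach extension over a convex set E of pairs (point, height), which
    plays the role of an epigraph.  The vector v0 lies below E on the subspace
    of T where the equations qs hold, and is modified by multiples of these
    equations only, hence keeps its values where they hold.  The subspace L is
    where the domain of E is entered: for each direction in T there is a point
    of L from which a positive multiple of that direction leads into that
    domain, which provides the points on both sides of each dropped equation. *)
Lemma dotv_extension (E : set ('cV[R]_m * R^o)) (L T : set 'cV[R]_m)
    (qs : seq 'cV[R]_m) v0 :
  convex_set E -> GRing.submod_closed (mem T) -> L `<=` T ->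
  (forall q, q \in qs -> forall z, L z -> dotv q z = 0) ->
  (forall u, T u ->
     exists (t : R) z (r : R), [/\ 0 < t, L z & E (z + t *: u, r)]) ->
  (forall z (r : R), T z -> (forall q, q \in qs -> dotv q z = 0) ->
     E (z, r) -> dotv v0 z <= r) ->
  exists v,
    (forall z, (forall q, q \in qs -> dotv q z = 0) -> dotv v z = dotv v0 z) /\
    (forall z (r : R), T z -> E (z, r) -> dotv v z <= r).
Proof.
move=> /convex_setP Ec Tsub LT; have [T0 Tlin] := Tsub.
have TD a z u : T z -> T u -> T (a *: z + u).
  by move=> Tz Tu; apply/set_mem/Tlin; apply/mem_set.
elim: qs v0 => [|q qs IH] v0 Lq core v0_le.
  by exists v0; split=> // z r Tz; exact: v0_le.
suff [c c_le] : exists c : R, forall z (r : R), T z ->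
    (forall q', q' \in qs -> dotv q' z = 0) -> E (z, r) ->
    dotv v0 z + c * dotv q z <= r.
  have [||v [v_eq v_le]] := IH (v0 + c *: q) _ core.
  - by move=> q' q'qs; apply: Lq; rewrite inE q'qs orbT.
  - by move=> z r Tz qz Ez; rewrite dotvDl dotvZl c_le.
  exists v; split=> // z qz; rewrite v_eq => [|q' q'qs].
    by rewrite dotvDl dotvZl (qz q) ?mem_head// mulr0 addr0.
  by rewrite qz// inE q'qs orbT.
(* If q vanishes on the subspace cut out by qs, there is nothing to choose. *)
have [[u [Tu uqs qu]]|nou] := pselect (exists u,
    [/\ T u, (forall q', q' \in qs -> dotv q' u = 0) & dotv q u != 0]); last first.
  exists 0 => z r Tz zqs Ez; rewrite mul0r addr0 v0_le// => q'.
  rewrite inE => /orP[/eqP ->|]; last exact: zqs.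
  by apply/eqP/negP => /negP qz; apply: nou; exists z.
(* The projection of E to the plane: the value of the dropped equation against
   the excess of the height over v0. *)
pose Q : set (R^o * R^o) := [set x | exists z (r : R), [/\ T z,
  (forall q', q' \in qs -> dotv q' z = 0), E (z, r) &
  x = (dotv q z, r - dotv v0 z)]].
have Q_of (a : R) : exists2 t : R, 0 < t & exists h, Q (t * (a * dotv q u), h).
  have [|t [z [r [t0 Lz Ez]]]] := core (a *: u).
    by rewrite -[a *: u]addr0; apply: (TD) => //; exact: set_mem.
  exists t => //; exists (r - dotv v0 (z + t *: (a *: u))), (z + t *: (a *: u)), r.
  split=> //.
  - rewrite scalerA addrC; apply: (TD) => //; exact: LT.
  - move=> q' q'qs; rewrite dotvDr !dotvZr uqs// !mulr0 addr0.
    by apply: Lq => //; rewrite inE q'qs orbT.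
  - by rewrite !dotvDr !dotvZr (Lq q _ z) ?mem_head// add0r.
have [||||c c_le] := @supporting_slope R Q.
- apply/convex_setP => _ _ a b a0 b0 ab [z [r [Tz zqs Ez ->]]] [z' [r' [Tz' z'qs Ez' ->]]] /=.
  exists (a *: z + b *: z'), (a * r + b * r'); split.
  - by apply: (TD) => //; rewrite -[b *: z']addr0; apply: (TD) => //; exact: set_mem.
  - by move=> q' q'qs; rewrite dotvDr !dotvZr zqs// z'qs// !mulr0 addr0.
  - exact: (Ec _ _ _ _ a0 b0 ab Ez Ez').
  - by rewrite !dotvDr !dotvZr; congr pair; rewrite /= !/(_ *: _) /=; lra.
- move=> h [z [r [Tz zqs Ez [qz ->]]]]; rewrite subr_ge0 v0_le// => q'.
  by rewrite inE => /orP[/eqP ->|]; [rewrite -qz | exact: zqs].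
- have [t t0 [h Qh]] := Q_of (dotv q u); eexists; first exact: Qh.
  by rewrite /= mulr_gt0// lt_def mulf_neq0//= -expr2 sqr_ge0.
- have [t t0 [h Qh]] := Q_of (- dotv q u); eexists; first exact: Qh.
  by rewrite /= pmulr_rlt0// mulNr oppr_lt0 lt_def mulf_neq0//= -expr2 sqr_ge0.
exists c => z r Tz zqs Ez; rewrite addrC -lerBrDr.
by apply: (c_le (dotv q z, r - dotv v0 z)); exists z, r.
Qed.

End Dot.

(** * The span of the smallest face through the origin *)

Section FaceSpan.
Variables (R : realType) (m : nat) (C : set 'cV[R]_m).
Hypotheses (Cconv : convex_set C) (C0 : C 0).

(** If u is not 0 then 0 is the midpoint of the open segment from u to - u, so
    that every face through 0 contains u. *)
Lemma span_face_hullN u : C u -> C (- u) ->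
  linear_span (face_hull C [set 0]) u.
Proof.
move=> Cu CNu V [_]; apply; split=> [_ -> //|F [[FC Fface] F0]].
have [->|u0] := eqVneq u 0; first exact: F0.
apply: (Fface u (- u) Cu CNu _).1; exists 0; split; last exact: F0.
split.
- exists (2^-1); first by rewrite /= in_itv/=; lra.
  by rewrite scalerN -scalerBl (_ : _ - _ = 0) ?scale0r//; lra.
- by case=> /esym/eqP; rewrite ?oppr_eq0 (negPf u0).
Qed.

Definition conic_hull : set 'cV[R]_m := [set u | exists2 a : R, 0 < a & C (a *: u)].

(* When C contains 0 the positive multiples of its points form a convex cone. *)
Let sub_conic u : C u -> conic_hull u.
Proof. by exists 1; rewrite ?scale1r. Qed.

Let conicZ (a : R) u : 0 <= a -> conic_hull u -> conic_hull (a *: u).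
Proof.
rewrite le_eqVlt => /orP[/eqP <- _|a0 [b b0 Cbu]].
  by rewrite scale0r; exact: sub_conic.
exists (b / a); first exact: divr_gt0.
by rewrite scalerA mulfVK ?gt_eqF.
Qed.

Let conicD u v : conic_hull u -> conic_hull v -> conic_hull (u + v).
Proof.
move=> [a a0 Cau] [b b0 Cbv]; have ab : 0 < a + b by exact: addr_gt0.
exists (a * b / (a + b)); first by rewrite divr_gt0// mulr_gt0.
have /convex_setP/(_ (a *: u) (b *: v) (b / (a + b)) (a / (a + b))) := Cconv.
rewrite !divr_gt0// -mulrDl (addrC b) divff ?gt_eqF// !scalerA.
move=> /(_ isT isT erefl Cau Cbv).
by rewrite mulrAC (mulrC b) (mulrAC a) -scalerDr.
Qed.

(** The vectors u with u and - u in the cone generated by C form a linear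
    subspace K, and the intersection of C and K is a face of C: if a point p of
    K lies in the open segment from y to z, then - y is a positive combination
    of - p and z.  This face contains 0, hence the smallest one, and its span is
    contained in K. *)
Lemma span_face_hull_sub_conic :
  linear_span (face_hull C [set 0]) `<=` conic_hull.
Proof.
pose K := [set u | conic_hull u /\ conic_hull (- u)].
suff FK : face_hull C [set 0] `<=` K.
  move=> u /(_ K)[]//; split=> //; split.
    by apply/mem_set; split; rewrite ?oppr0; exact: sub_conic.
  move=> a v w /set_mem[Pv PNv] /set_mem[Pw PNw]; apply/mem_set.
  have [a0|a0] := leP 0 a; split; rewrite ?opprD; apply: conicD => //.
  - exact: conicZ.
  - by rewrite -scalerN; exact: conicZ.
  - by rewrite -[a *: v]opprK -scaleNr -scalerN; apply: conicZ => //; lra.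
  - by rewrite -scaleNr; apply: conicZ => //; lra.
move=> u [_ /(_ (C `&` K))[]//]; split=> [|_ ->]; last first.
  by split=> //; split; rewrite ?oppr0; exact: sub_conic.
split=> [v []//|y z Cy Cz [p [[[t]]]]].
rewrite /= in_itv/= => /andP[t0 t1] <- pyz [_ [_ PNp]].
have {}t0 : 0 < t.
  rewrite lt_def t0 andbT; apply/eqP => t_0; apply: pyz; left.
  by rewrite t_0 subr0 scale1r scale0r addr0.
have {}t1 : 0 < 1 - t.
  rewrite lt_def subr_ge0 t1 andbT; apply/eqP => t_1; apply: pyz; right => /=.
  by rewrite t_1 (_ : t = 1) ?scale0r ?scale1r ?add0r//; lra.
have PNl (b c : R) (x x' : 'cV[R]_m) : 0 < b -> 0 < c -> C x' ->
    conic_hull (- (b *: x + c *: x')) -> conic_hull (- x).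
  move=> b0 c0 Cx' Pbc.
  have -> : - x = b^-1 *: (- (b *: x + c *: x') + c *: x').
    by rewrite opprD subrK scalerN scalerA mulVf ?scale1r ?gt_eqF.
  apply: conicZ; first by rewrite invr_ge0 ltW.
  by apply: conicD => //; apply: conicZ (ltW c0) _; exact: sub_conic.
split; split=> //; split; try exact: sub_conic.
- exact: (PNl _ _ _ _ t1 t0 Cz PNp).
- by apply: (PNl _ _ _ _ t0 t1 Cy); rewrite addrC.
Qed.

End FaceSpan.

(** * Convexity of the domain and equations for the range *)

Lemma set_diff_convex (R : realType) m (C D : set 'cV[R]_m) :
  convex_set C -> convex_set D -> convex_set (set_diff C D).
Proof.
move=> /convex_setP Cc /convex_setP Dc; apply/convex_setP.
move=> _ _ a b a0 b0 ab [c Cx [d Dx <-]] [c' Cx' [d' Dx' <-]].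
exists (a *: c + b *: c'); first exact: Cc.
exists (a *: d + b *: d'); first exact: Dc.
by rewrite !scalerBr opprD addrACA.
Qed.

Lemma range_mulmx_convex (R : realType) m n (A : 'M[R]_(m, n)) :
  convex_set (range (mulmx A) : set 'cV[R]_m).
Proof.
apply/convex_setP => _ _ a b _ _ _ [y _ <-] [z _ <-].
by exists (a *: y + b *: z) => //; rewrite mulmxDr -!scalemxAr.
Qed.

Lemma edom_convex (R : realType) m (g : 'cV[R]_m -> \bar R) :
  convex_efun g -> (forall x, g x <> -oo%E) -> convex_set (edom g).
Proof.
move=> /convex_setP gc gNy; apply/convex_setP => x y a b a0 b0 ab gx gy.
have fing z : edom g z -> epigraph g (z, fine (g z)).
  by rewrite /epigraph /edom/=; have := gNy z; case: (g z).
have := gc _ _ a b a0 b0 ab (fing _ gx) (fing _ gy).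
by rewrite /epigraph/edom/=; case: (g _).
Qed.

Lemma dotv_col (R : realType) m k (w : 'cV[R]_m) (K : 'M_(m, k)) j :
  dotv w (col j K) = (w^T *m K) 0 j.
Proof. by rewrite /dotv colE mulmxA -colE mxE. Qed.

(** The range of A^T is the orthogonal of ker A: the cokernel matrix of A has
    its columns in ker A and tests membership in the row space of A. *)
Lemma trmx_image (R : realType) m n (A : 'M[R]_(m, n)) (w : 'cV[R]_n) :
  (forall y, A *m y = 0 -> dotv w y = 0) -> exists v, A^T *m v = w.
Proof.
move=> Aw; have /submxP[v wv] : (w^T <= A)%MS.
  rewrite submxE; apply/eqP/rowP => j.
  rewrite -dotv_col [RHS]mxE; apply: Aw.
  by rewrite colE mulmxA mulmx_coker mul0mx.
by exists v^T; rewrite -[w]trmxK wv trmx_mul.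
Qed.

(** A subspace given as a range is turned into one given by equations: the
    columns of the cokernel matrix of A^T, tested against z^T. *)
Lemma range_mulmx_eqs (R : realType) m n (A : 'M[R]_(m, n)) :
  exists qs : seq 'cV[R]_m, forall z,
    (forall q, q \in qs -> dotv q z = 0) <-> range (mulmx A) z.
Proof.
exists [seq col j (cokermx A^T) | j : 'I_m] => z; split=> [zqs|[y _ <-] q].
  have /submxP[y zy] : (z^T <= A^T)%MS.
    rewrite submxE; apply/eqP/rowP => j.
    by rewrite -dotv_col [RHS]mxE dotvC; apply/zqs/map_f; rewrite mem_enum.
  by exists y^T => //; rewrite -[z]trmxK zy trmx_mul trmxK.
case/mapP => j _ ->; rewrite dotvC dotv_col trmx_mul -mulmxA mulmx_coker.
by rewrite mulmx0 mxE.
Qed.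

(** * The chain rule *)

Theorem corollary5p3 (R : realType) (m n : nat) (g : 'cV[R]_m -> \bar R)
    (A : 'M[R]_(m, n)) (g_convex : convex_efun g) (g_proper : proper_efun g) :
  let T := joint_support (edom g) (range (mulmx A)) in
  forall x : 'cV[R]_n,
    subdifferential (g \o mulmx A) x =
    mulmx A^T @` subdifferential (g \+ eindic T)%E (A *m x).
Proof.
move=> T x; have [gNy _] := g_proper.
have dotA v y : dotv v (A *m y) = dotv (A^T *m v) y.
  by rewrite /dotv trmx_mul trmxK mulmxA.
have gT z : T z -> (g \+ eindic T)%E z = g z.
  by move=> Tz; rewrite /= /eindic mem_set// adde0.
have gNT z : ~ T z -> (g \+ eindic T)%E z = +oo%E.
  move=> Tz; rewrite /= /eindic memNset//.
  by have := gNy z; case: (g z).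
(* Outside the domain of g o A both sides are empty. *)
have [gAx|gAx] := pselect (edom g (A *m x)); last first.
  apply/seteqP; split=> [w [gx _]|_ [v [Tgx _] <-]].
    by case: (gAx gx).
  exfalso; apply: Tgx; have [Tx|/gNT//] := pselect (T (A *m x)).
  by rewrite gT//; apply: contrapT.
have [g0 g0E] : exists g0 : R, g (A *m x) = g0%:E.
  by move: gAx (gNy (A *m x)); rewrite /edom/=; case: (g _) => // r; exists r.
pose C := set_diff (edom g) (range (mulmx A)).
have Cconv : convex_set C.
  by apply: set_diff_convex; [exact: edom_convex | exact: range_mulmx_convex].
have CA y : C (A *m y).
  by exists (A *m x) => //; exists (A *m (x - y)) => //; rewrite -mulmxBr subKr.
have C0 : C 0 by rewrite -(mulmx0 _ A); exact: CA.
have AT y : T (A *m y).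
  by apply: (span_face_hullN C0); rewrite -?mulmxN; exact: CA.
have Tsub : GRing.submod_closed (mem T).
  split; first by apply/mem_set; rewrite -(mulmx0 _ A); exact: AT.
  move=> a u v /set_mem Tu /set_mem Tv; apply/mem_set => V VP.
  have [_ Vlin] := VP.1.
  by apply/set_mem/Vlin; apply/mem_set; [exact: Tu | exact: Tv].
apply/seteqP; split=> [w [_ w_sub]|_ [v [_ v_sub] <-]]; last first.
  split=> // y; have := v_sub (A *m y).
  by rewrite !gT// /= -dotA mulmxBr.
(* The subgradient inequality for w, in terms of real upper bounds of g. *)
have w_le y (r : R) : (g (A *m x + A *m y)%R <= (g0 + r)%:E)%E -> dotv w y <= r.
  move=> gr; have := w_sub (x + y).
  rewrite /= mulmxDr g0E addrAC subrr add0r => /le_trans/(_ gr).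
  by rewrite -EFinD lee_fin lerD2l.
have [v0 v0w] : exists v, A^T *m v = w.
  apply: trmx_image => y Ay; apply/le_anti/andP; split.
    by apply: w_le; rewrite Ay !addr0 g0E.
  rewrite -lerN2 oppr0 -mulN1r -dotvZr; apply: w_le.
  by rewrite -scalemxAr Ay scaler0 !addr0 g0E.
have [qs qsP] := range_mulmx_eqs A.
(* The epigraph of g, translated so that (A x, g (A x)) is at the origin. *)
pose E : set ('cV[R]_m * R^o) := [set p | (g (A *m x + p.1)%R <= (g0 + p.2)%:E)%E].
have [|_ [y _ <-]|q q_qs z|u Tu|z r _|v [v_eq v_le]] :=
    @dotv_extension R m E (range (mulmx A)) T qs v0 _ Tsub.
- apply/convex_setP => p p' a b a0 b0 ab Ep Ep'.
  have /convex_setP/(_ (A *m x + p.1, g0 + p.2) (A *m x + p'.1, g0 + p'.2)) := g_convex.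
  move=> /(_ _ _ a0 b0 ab Ep Ep'); rewrite /E/epigraph/=.
  rewrite !scalerDr addrACA -scalerDl ab scale1r.
  by rewrite addrACA -scalerDl ab scale1r.
- exact: AT.
- by move=> /qsP; exact.
- have [a a0 [c gc [_ [y _ <-] cE]]] := span_face_hull_sub_conic Cconv C0 Tu.
  have [r gr] : exists r : R, (g c <= (g0 + r)%:E)%E.
    exists (fine (g c) - g0); rewrite addrC subrK.
    by move: gc (gNy c); rewrite /edom/=; case: (g c).
  exists a, (A *m (y - x)), r; split=> //; rewrite /E/= -cE mulmxBr.
  by rewrite addrA (addrC _ (A *m y - _)) subrK addrC subrK.
- by move=> /qsP[y _ <-] Ez; rewrite dotA v0w; exact: w_le.
exists v.
  split; first by rewrite /edom/= gT// g0E.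
  move=> z; have [Tz|/gNT ->] := pselect (T z); last by rewrite leey.
  rewrite !gT// g0E -EFinD.
  have := gNy z; case gzE : (g z) => [r| |] // _; last by rewrite leey.
  rewrite lee_fin addrC -lerBrDr; apply: v_le.
    rewrite addrC -scaleN1r; apply/set_mem/Tsub.2; exact/mem_set.
  by rewrite /E/= addrC subrK addrC subrK gzE.
apply/colP => i; have : forall y, dotv (A^T *m v) y = dotv w y.
  by move=> y; rewrite -dotA v_eq ?dotA ?v0w//; exact/qsP.
move=> /(_ (delta_mx i 0)).
by rewrite /dotv -!colE !mxE.
Qed.
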